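(* Let $\ell$ be a nonnegative integer. Let $a_0=1$ and, for $n\ge1$, $a_n=\chi_{P_n}(1,\ell)$ and $b_n=\chi_{C_n}(1,\ell)$. Then, for all integers $n,r,s,t$ for which every subscript appearing is nonnegative (and every subscript of $b$ is at least $1$), \begin{align*} b_n &= \ell a_{n-1}+\ell^2 a_{n-3},\\ b_n &= a_{n}-\ell^2 a_{n-4},\\ a_{r+s} &= \ell a_ra_{s-1}+\ell^2a_{r-1}a_{s-2},\\ a_{r+s} &= a_ra_s-\ell^2a_{r-2}a_{s-2},\\ a_{r+s+t+1} &= \ell a_ra_sa_t + \ell^3a_{r-1}a_{s-1}a_{t-1}-\ell^4a_{r-2}a_{s-2}a_{t-2}. \end{align*}
   Context: For nonnegative integers $k,\ell$, a $(k,\ell)$-coloring of a graph $G$ with vertex set $V$ is a map $\varphi: V\to\{c_1,\dots,c_{k+\ell}\}$; the colors $c_{k+1},\dots,c_{k+\ell}$ are wildcards. It is proper if whenever vertices $i,j$ are adjacent (including $i=j$ via a loop) and $\varphi(i),\varphi(j)\in\{c_1,\dots,c_k\}$, then $\varphi(i)\ne\varphi(j)$. $\chi_G(k,\ell)$ is the number of proper $(k,\ell)$-colorings of $G$. $P_n$ is the path graph on $n$ vertices and $C_n$ the cycle graph on $n$ vertices, where $C_1$ is a single vertex with a loop and $C_2$ is two vertices joined by two parallel edges. (With $k=1$ one has $a_n=\ell a_{n-1}+\ell a_{n-2}$ and $b_n=\ell b_{n-1}+\ell b_{n-2}$.) *)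

(* Defs.v *)
From mathcomp Require Import all_boot.

Set Implicit Arguments.
Unset Strict Implicit.
Unset Printing Implicit Defensive.

(* Finite undirected multigraphs, loops and parallel edges allowed; the order
   of the two endpoints of an edge is immaterial (see adjacent). *)
Record multigraph := Multigraph {
  vertex : finType;
  edge : finType;
  ends : edge -> vertex * vertex
}.

Definition adjacent (G : multigraph) : rel (vertex G) :=
  fun i j => [exists e : edge G, (ends e == (i, j)) || (ends e == (j, i))].

(* The color c_(m+1) is represented by m : 'I_(k + l), so the wildcards are
   the m with k <= m. *)
Definition proper_coloring (G : multigraph) (k l : nat)
    (phi : {ffun vertex G -> 'I_(k + l)}) : bool :=
  [forall i, forall j,
    [&& adjacent i j, phi i < k & phi j < k] ==> (phi i != phi j)].

Definition chi (G : multigraph) (k l : nat) : nat :=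
  #|[set phi : {ffun vertex G -> 'I_(k + l)} | proper_coloring phi]|.

Definition path_graph (n : nat) : multigraph :=
  @Multigraph 'I_n {i : 'I_n | i.+1 < n}
    (fun e => (val e, Ordinal (valP e))).

(* ordS is the cyclic successor, so that cycle_graph 1 is a vertex with a loop
   and cycle_graph 2 has two parallel edges. *)
Definition cycle_graph (n : nat) : multigraph :=
  @Multigraph 'I_n 'I_n (fun i => (i, ordS i)).

(* Main.v *)
Require Import Defs.
From HB Require Import structures.
From mathcomp Require Import all_boot all_order all_algebra.
From mathcomp Require Import zify ring.

(* A proper coloring of a path (resp. a cycle) is a word that is sorted (resp.
   cyclic) for the relation "compatible".  When k = 1, a wildcard decouples its
   two sides while the color c_1 forces its neighbours to be wildcards, so
   reading off the first letter gives a_(n+2) = l a_(n+1) + l a_n and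
   b_(n+3) = l a_(n+2) + l^2 a_n.  The recurrence for a yields the first
   addition formula by induction on r; all the others follow from it
   algebraically. *)

Set Implicit Arguments.
Unset Strict Implicit.
Unset Printing Implicit Defensive.

Definition compatible (k l : nat) : rel 'I_(k + l) :=
  fun x y => (x < k) && (y < k) ==> (x != y).

Lemma compatible_sym k l : symmetric (@compatible k l).
Proof. by move=> x y; rewrite /compatible andbC eq_sym. Qed.

(** Since [compatible] is symmetric, testing each edge in its stored orientation suffices. A loop
    forces a wildcard, because an ordinary color is not compatible with itself. *)
Lemma proper_coloringE (G : multigraph) k l
    (phi : {ffun vertex G -> 'I_(k + l)}) :
  proper_coloring phi =
  [forall e : edge G, compatible (phi (ends e).1) (phi (ends e).2)].
Proof.
apply/'forall_forallP/forallP => [phiP e | phiP i j].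
  have /implyP phie := phiP (ends e).1 (ends e).2.
  apply/implyP => /andP[lt1 lt2]; apply: phie; rewrite lt1 lt2 !andbT.
  by apply/existsP; exists e; rewrite -surjective_pairing eqxx.
apply/implyP => /and3P[/existsP[e eij] lti ltj].
have := phiP e; case/orP: eij => /eqP -> /=; last rewrite compatible_sym.
  by rewrite /compatible lti ltj.
by rewrite /compatible lti ltj.
Qed.

(** The predicate lives on sequences of every length, so that a first letter can be peeled off
    without casts between tuple types. *)
Definition words (T : finType) (P : pred (seq T)) (n : nat) : nat :=
  #|[set t : n.-tuple T | P t]|.

Lemma eq_words (T : finType) (P Q : pred (seq T)) n :
  P =1 Q -> words P n = words Q n.
Proof. by move=> eqPQ; apply: eq_card => t; rewrite !inE eqPQ. Qed.

Lemma words0 (T : finType) (P : pred (seq T)) : words P 0 = P [::].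
Proof.
have tE (t : 0.-tuple T) : t = [tuple] by apply: tuple0.
rewrite /words; case P0 : (P [::]).
  rewrite /= -(cards1 ([tuple] : 0.-tuple T)); apply: eq_card => t.
  by rewrite !inE (tE t) eqxx P0.
by apply: eq_card0 => t; rewrite !inE (tE t) P0.
Qed.

Lemma wordsS (T : finType) (P : pred (seq T)) n :
  words P n.+1 = \sum_(x : T) words (fun s => P (x :: s)) n.
Proof.
rewrite /words -sum1_card.
under [RHS]eq_bigr => x _ do rewrite -sum1_card.
rewrite pair_big_dep /=.
rewrite (reindex (fun p : T * n.-tuple T => [tuple of p.1 :: p.2])) /=.
  by apply: eq_bigl => p; rewrite !inE.
exists (fun t : n.+1.-tuple T => (thead t, [tuple of behead t])).
  by case=> x t _ /=; congr pair; apply: val_inj.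
by move=> t _; rewrite -tuple_eta.
Qed.

Lemma words_pred0 (T : finType) (P : pred (seq T)) n :
  P =1 pred0 -> words P n = 0.
Proof. by move=> P0; apply: eq_card0 => t; rewrite inE P0. Qed.

Lemma words_rev (T : finType) (P : pred (seq T)) n :
  words (fun s => P (rev s)) n = words P n.
Proof.
pose r (t : n.-tuple T) := [tuple of rev t].
have rK : involutive r by move=> t; apply: val_inj; rewrite /= revK.
rewrite /words -(card_imset _ (can_inj rK)); apply: eq_card => t.
rewrite -[t]rK mem_imset ?inE /= ?revK //; exact: can_inj rK.
Qed.

Lemma card_ffun_words (T : finType) (P : pred (seq T)) n
    (Q : pred {ffun 'I_n -> T}) :
  (forall f : {ffun 'I_n -> T}, Q f = P [tuple f i | i < n]) ->
  #|[set f | Q f]| = words P n.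
Proof.
move=> QE; pose F (f : {ffun 'I_n -> T}) := [tuple f i | i < n].
pose G (t : n.-tuple T) := [ffun i => tnth t i].
have FK : cancel F G by move=> f; apply/ffunP => i; rewrite ffunE tnth_mktuple.
have GK : cancel G F.
  by move=> t; apply: eq_from_tnth => i; rewrite tnth_mktuple ffunE.
rewrite /words -(card_imset _ (can_inj FK)); apply: eq_card => t.
rewrite inE -[t]GK mem_imset ?inE ?QE //; exact: can_inj FK.
Qed.

Lemma chi_path_graph k l n :
  chi (path_graph n) k l = words (sorted (@compatible k l)) n.
Proof.
apply: card_ffun_words => f; rewrite proper_coloringE.
case: n f => [|n] f.
  rewrite (tuple0 [tuple f i | i < 0]) /=.
  by apply/forallP => -[[]].
(* The default [x0] is never read, but it needs a vertex to exist; hence the separate treatment of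
   the empty graph. *)
set t := [tuple f i | i < n.+1]; pose x0 := f ord0.
have tE i : nth x0 t (val i) = f i by apply: nth_mktuple.
apply/forallP/(sortedP x0) => [fP i | fP [i lti]].
  rewrite size_tuple => lti.
  have := fP (exist _ (Ordinal (ltnW lti)) lti).
  by rewrite /= -!tE.
by rewrite /= -!tE; apply: fP; rewrite size_tuple.
Qed.

Lemma chi_cycle_graph k l n :
  chi (cycle_graph n) k l = words (cycle (@compatible k l)) n.
Proof.
apply: card_ffun_words => f; rewrite proper_coloringE.
case: n f => [|n] f.
  rewrite (tuple0 [tuple f i | i < 0]) /=.
  by apply/forallP => -[].
set t := [tuple f i | i < n.+1]; pose x0 := f ord0.
have tE i : f i = nth x0 t i by rewrite nth_mktuple.
case: t tE => -[//|x p] /= /eqP[szp] tE.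
(* [cycle] on [x :: p] is [path] from [x] along [rcons p x]. The appended copy of [x] is the cyclic
   successor of the last vertex, so the i-th step of this path is the i-th edge. *)
have eqS (i : 'I_n.+1) : nth x0 (rcons p x) i = nth x0 (x :: p) (ordS i).
  rewrite nth_rcons szp /=; have := ltn_ord i; rewrite ltnS leq_eqVlt.
  case/orP => [/eqP -> | lti]; first by rewrite ltnn eqxx modnn.
  by rewrite lti modn_small.
have eqI (i : 'I_n.+1) : nth x0 (x :: rcons p x) i = nth x0 (x :: p) i.
  by rewrite -rcons_cons nth_rcons /= szp ltn_ord.
apply/forallP/(pathP x0) => [fP i | fP i].
  rewrite size_rcons szp => lti.
  by rewrite (eqI (Ordinal lti)) (eqS (Ordinal lti)) -!tE; apply: fP.
by rewrite /= !tE -eqS -eqI; apply: fP; rewrite size_rcons szp.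
Qed.

Section OneOrdinaryColor.

Variable l : nat.

Local Notation C := (@compatible 1 l).
Local Notation c1 := (ord0 : 'I_(1 + l)).
Local Notation wild i := (lift ord0 i : 'I_(1 + l)).
Local Notation A := (words (sorted C)).

(** Split on the first letter: the [l] wildcards impose the same condition [Q] on the tail and are
    counted together. *)
Lemma words_wildS (P Q : pred (seq 'I_(1 + l))) n :
  (forall (i : 'I_l) s, P (wild i :: s) = Q s) ->
  words P n.+1 = l * words Q n + words (fun s => P (c1 :: s)) n.
Proof.
move=> PQ; rewrite wordsS big_ord_recl addnC; congr (_ + _).
under eq_bigr => i _ do rewrite (eq_words _ (PQ i)).
by rewrite sum_nat_const card_ord.
Qed.

Lemma words_wild_onlyS (P Q : pred (seq 'I_(1 + l))) n :
  (forall (i : 'I_l) s, P (wild i :: s) = Q s) ->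
  (forall s, P (c1 :: s) = false) ->
  words P n.+1 = l * words Q n.
Proof.
by move=> PQ P0; rewrite (words_wildS _ PQ) (words_pred0 _ P0) addn0.
Qed.

Lemma compatible_wildr (i : 'I_l) x : C x (wild i).
Proof. by rewrite compatible_sym. Qed.

Lemma path_wild (i : 'I_l) s : path C (wild i) s = sorted C s.
Proof. by case: s. Qed.

Lemma words_path_c1 n : words (path C c1) n.+1 = l * A n.
Proof.
apply: words_wild_onlyS => // i s.
by rewrite /= path_wild.
Qed.

Lemma words_sortedS n : A n.+1 = l * A n + words (path C c1) n.
Proof. by apply: words_wildS => i s; apply: path_wild. Qed.

Lemma words_sorted_rec n : A n.+2 = l * A n.+1 + l * A n.
Proof. by rewrite words_sortedS words_path_c1. Qed.

Lemma words_sorted0 : A 0 = 1.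
Proof. by rewrite words0. Qed.

Lemma words_sorted1 : A 1 = l + 1.
Proof. by rewrite words_sortedS !words0 muln1. Qed.

Lemma words_sorted_rcons_c1 n :
  words (fun s => sorted C (rcons s c1)) n = words (path C c1) n.
Proof.
rewrite -words_rev; apply: eq_words => s.
rewrite -rev_sorted rev_rcons revK /=; apply: eq_path => x y.
exact: compatible_sym.
Qed.

(** These are the tails of cyclic words that begin with [c1]. Both end letters must be wildcards;
    with at least two letters these ends are distinct, and the [n] letters between them form an
    arbitrary sorted word. *)
Lemma words_path_rcons_c1 n :
  words (fun s => path C c1 (rcons s c1)) n.+2 = l ^ 2 * A n.
Proof.
rewrite (@words_wild_onlyS _ (fun s => sorted C (rcons s c1))) // => [|i s].
  by rewrite words_sorted_rcons_c1 words_path_c1 mulnA.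
by rewrite /= path_wild.
Qed.

Lemma words_cycle n : words (cycle C) n.+3 = l * A n.+2 + l ^ 2 * A n.
Proof.
rewrite (@words_wildS _ (sorted C)) => [|i s]; last first.
  (* A leading wildcard accepts both of its cyclic neighbours, so cutting there leaves a linear
     word. *)
  rewrite /= path_wild; case: s => // x s /=.
  by rewrite rcons_path compatible_wildr andbT.
by rewrite words_path_rcons_c1.
Qed.

(** Combinatorially, look at the letter preceded by [r.+1] letters and followed by [s.+1]: a
    wildcard gives the first term, and [c1], which forces wildcards on both sides, gives the
    second. *)
Lemma words_sorted_add r s :
  A (r + s).+3 = l * A r.+1 * A s.+1 + l ^ 2 * A r * A s.
Proof.
(* The recurrence has order two, so the induction carries two consecutive values of [r]. *)
have [] : A (r + s).+3 = l * A r.+1 * A s.+1 + l ^ 2 * A r * A s /\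
  A (r + s).+4 = l * A r.+2 * A s.+1 + l ^ 2 * A r.+1 * A s; last by [].
elim: r => [|r [IH1 IH2]].
  rewrite !add0n !words_sorted_rec words_sorted1 words_sorted0.
  by split; ring.
split; first by rewrite (addSn r s) IH2.
rewrite (addSn r s) (words_sorted_rec (r + s).+3) IH1 IH2 !words_sorted_rec.
by ring.
Qed.

End OneOrdinaryColor.

Import GRing.Theory.
Local Open Scope ring_scope.

Theorem theorem2p1 (l : nat) (a b : nat -> nat)
    (a_0 : a 0%N = 1%N)
    (a_path : forall n : nat, (1 <= n)%N -> a n = chi (path_graph n) 1 l)
    (b_cycle : forall n : nat, (1 <= n)%N -> b n = chi (cycle_graph n) 1 l) :
  (forall n : nat, (3 <= n)%N ->
     (b n)%:Z = l%:Z * (a (n - 1)%N)%:Z + l%:Z ^+ 2 * (a (n - 3)%N)%:Z) /\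
  (forall n : nat, (4 <= n)%N ->
     (b n)%:Z = (a n)%:Z - l%:Z ^+ 2 * (a (n - 4)%N)%:Z) /\
  (forall r s : nat, (1 <= r)%N -> (2 <= s)%N ->
     (a (r + s)%N)%:Z = l%:Z * (a r)%:Z * (a (s - 1)%N)%:Z
       + l%:Z ^+ 2 * (a (r - 1)%N)%:Z * (a (s - 2)%N)%:Z) /\
  (forall r s : nat, (2 <= r)%N -> (2 <= s)%N ->
     (a (r + s)%N)%:Z = (a r)%:Z * (a s)%:Z
       - l%:Z ^+ 2 * (a (r - 2)%N)%:Z * (a (s - 2)%N)%:Z) /\
  (forall r s t : nat, (2 <= r)%N -> (2 <= s)%N -> (2 <= t)%N ->
     (a (r + s + t + 1)%N)%:Z = l%:Z * (a r)%:Z * (a s)%:Z * (a t)%:Z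
       + l%:Z ^+ 3 * (a (r - 1)%N)%:Z * (a (s - 1)%N)%:Z * (a (t - 1)%N)%:Z
       - l%:Z ^+ 4 * (a (r - 2)%N)%:Z * (a (s - 2)%N)%:Z * (a (t - 2)%N)%:Z).
Proof.
have aE n : a n = words (sorted (@compatible 1 l)) n.
  case: n => [|n]; first by rewrite a_0 words_sorted0.
  by rewrite a_path // chi_path_graph.
have aS n : (a n.+2)%:Z = l%:Z * (a n.+1)%:Z + l%:Z * (a n)%:Z.
  by rewrite !aE words_sorted_rec PoszD !PoszM.
have bE n : (b n.+3)%:Z = l%:Z * (a n.+2)%:Z + l%:Z ^+ 2 * (a n)%:Z.
  by rewrite b_cycle // chi_cycle_graph words_cycle !aE PoszD !PoszM.
have aD r s : (a (r + s).+3)%:Z =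
    l%:Z * (a r.+1)%:Z * (a s.+1)%:Z + l%:Z ^+ 2 * (a r)%:Z * (a s)%:Z.
  by rewrite !aE words_sorted_add PoszD !PoszM.
split; last split; last split; last split.
- by case=> [|[|[|n]]] // _; rewrite bE !subSS !subn0.
- case=> [|[|[|[|n]]]] // _.
  (* Expanding a_(n+4), and then a_(n+2) inside it, gives the value of b_(n+4) plus l^2 a_n. *)
  by rewrite bE !subSS subn0 (aS n.+2) (aS n); ring.
- case=> // r [|[|s]] // _ _.
  by rewrite !subSS !subn0 addSn !addnS aD.
- case=> [|[|r]] // [|[|s]] // _ _.
  by rewrite !subSS !subn0 !addSn !addnS (aD r.+1) !aS; ring.
- case=> [|[|r]] // [|[|s]] // [|[|t]] // _ _ _.
  rewrite !subSS !subn0 addn1.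
  (* This form lets [aD] split off [r], leaving the factors a_(s+t+4) and a_(s+t+3), which [aD]
     splits again; the recurrence does the rest. *)
  have -> : (r.+2 + s.+2 + t.+2).+1 = (r.+1 + (s + t).+3).+3 by lia.
  by rewrite (aD r.+1) -addSn (aD s.+1) addSn (aD s) !aS; ring.
Qed.
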